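(* Let $\alpha,\beta>-1$, $N\ge1$, and let $\mathcal S=\{s_1,\ldots,s_N\}$ be an $\omega_{\alpha,\beta}$-admissible family of nondegenerate intervals in $[-1,1]$. Then \[ D_N^{(\alpha,\beta)}=\frac12\left(A_N^{(\alpha,\beta)}+B_N^{(\alpha,\beta)}\right)C_N^{(\alpha,\beta)}, \] where the four $N\times N$ matrices are defined, for $i,k=1,\ldots,N$, by \[ [D_N^{(\alpha,\beta)}]_{ik}=\int_{s_i}\frac{d}{dx}P_k^{(\alpha,\beta)}(x)\,\omega_{\alpha,\beta}(x)\,dx, \] \[ [A_N^{(\alpha,\beta)}]_{ik}=\int_{s_i}P_{k-1}^{(\alpha+1,\beta+1)}(x)\,\omega_{\alpha+1,\beta}(x)\,dx,\qquad [B_N^{(\alpha,\beta)}]_{ik}=\int_{s_i}P_{k-1}^{(\alpha+1,\beta+1)}(x)\,\omega_{\alpha,\beta+1}(x)\,dx, \] \[ C_N^{(\alpha,\beta)}=\operatorname{diag}\left(\frac{k+\alpha+\beta+1}{2}\right)_{k=1}^N . \]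
   Context: $\omega_{a,b}(x)=(1-x)^a(1+x)^b$ on $(-1,1)$ for $a,b>-1$. $P_k^{(a,b)}$ is the Jacobi polynomial of degree $k$ in the standard normalization (i.e. $P_k^{(a,b)}(1)=\binom{k+a}{k}$). $\Pi_{n}$ is the space of real univariate polynomials of degree at most $n$. A family of intervals $s_i=[a_i,b_i]\subset[-1,1]$, $a_i<b_i$, $i=1,\ldots,N$, is $\omega$-admissible if the linear map $\Pi_{N-1}\to\mathbb R^N$, $q\mapsto[\int_{s_i}q\,\omega\,dx]_{i=1}^N$, is an isomorphism. *)

(* Defs.v *)
From HB Require Import structures.
From mathcomp Require Import all_boot all_order all_algebra.
From mathcomp Require Import all_classical all_reals all_analysis.
From mathcomp Require Import ring lra.

Set Implicit Arguments.
Unset Strict Implicit.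
Unset Printing Implicit Defensive.

Import Order.TTheory GRing.Theory Num.Theory.
Import numFieldNormedType.Exports.

Local Open Scope classical_set_scope.
Local Open Scope ring_scope.

Definition gbin (F : fieldType) (x : F) (n : nat) : F :=
  (\prod_(i < n) (x - i%:R)) / n`!%:R.

(* The weight is meant on (-1, 1).  At an endpoint where it is singular, [powR]
   returns 0; this null set does not affect the integrals below. *)
Definition jweight (R : realType) (a b x : R) : R :=
  (1 - x) `^ a * (1 + x) `^ b.

(* The Leibniz expansion of Rodrigues' formula
   (-1)^n / (2^n n!) (1-x)^-a (1+x)^-b (d/dx)^n [(1-x)^(n+a) (1+x)^(n+b)]. *)
Definition jacobi (R : realType) (a b : R) (n : nat) : {poly R} :=
  \sum_(s < n.+1) (gbin (n%:R + a) (n - s) * gbin (n%:R + b) s) *: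
     ((2^-1 *: ('X - 1)) ^+ s * (2^-1 *: ('X + 1)) ^+ (n - s)).

(* [{poly_N R}] consists of the polynomials of degree at most N - 1, and the
   map below is linear as soon as [w] is integrable on each interval, so
   bijectivity is what is left of "is an isomorphism". *)
Definition admissible (R : realType) (w : R -> R) (N : nat)
    (l r : 'I_N -> R) : Prop :=
  bijective (fun q : {poly_N R} =>
    (\col_(i < N) \int[lebesgue_measure]_(x in `[l i, r i])
                    ((q : {poly R}).[x] * w x)) : 'cV[R]_N).

Definition jacobiD (R : realType) (a b : R) (N : nat) (l r : 'I_N -> R)
    : 'M[R]_N :=
  \matrix_(i < N, k < N) \int[lebesgue_measure]_(x in `[l i, r i])
    (derive1 (fun t : R => (jacobi a b k.+1).[t]) x * jweight a b x).

Definition jacobiA (R : realType) (a b : R) (N : nat) (l r : 'I_N -> R)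
    : 'M[R]_N :=
  \matrix_(i < N, k < N) \int[lebesgue_measure]_(x in `[l i, r i])
    ((jacobi (a + 1) (b + 1) k).[x] * jweight (a + 1) b x).

Definition jacobiB (R : realType) (a b : R) (N : nat) (l r : 'I_N -> R)
    : 'M[R]_N :=
  \matrix_(i < N, k < N) \int[lebesgue_measure]_(x in `[l i, r i])
    ((jacobi (a + 1) (b + 1) k).[x] * jweight a (b + 1) x).

Definition jacobiC (R : realType) (a b : R) (N : nat) : 'M[R]_N :=
  diag_mx (\row_(k < N) ((k.+1%:R + a + b + 1) / 2)).

Lemma gbin0 (F : fieldType) (x : F) : gbin x 0 = 1.
Proof. by rewrite /gbin big_ord0 fact0 divr1. Qed.

Lemma gbin_nat (R : realType) (m n : nat) :
  (n <= m)%N -> gbin (m%:R : R) n = 'C(m, n)%:R.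
Proof.
move=> nm; rewrite /gbin; apply: (canLR (mulfK _)).
  by rewrite pnatr_eq0 -lt0n fact_gt0.
rewrite -natrM bin_ffact ffact_prod natr_prod; apply: eq_bigr => i _.
by rewrite natrB // ltnW // (leq_trans (ltn_ord i)).
Qed.

Lemma gbinS (R : realType) (x : R) (n : nat) :
  n.+1%:R * gbin x n.+1 = (x - n%:R) * gbin x n.
Proof.
rewrite /gbin big_ord_recr /= factS natrM.
have h1 : (n.+1%:R : R) != 0 by rewrite pnatr_eq0.
have h2 : (n`!%:R : R) != 0 by rewrite pnatr_eq0 -lt0n fact_gt0.
by rewrite invfM; field; apply/andP; split=> //; rewrite -natr1 in h1.
Qed.

Lemma gbin_Vandermonde (R : realType) (x y : R) (n : nat) :
  \sum_(s < n.+1) gbin x (n - s) * gbin y s = gbin (x + y) n.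
Proof.
elim: n => [|n IH]; first by rewrite big_ord1 !gbin0 mulr1.
have h1 : (n.+1%:R : R) != 0 by rewrite pnatr_eq0.
apply: (mulfI h1); rewrite gbinS -IH !mulr_sumr.
transitivity
  (\sum_(s < n.+2) (n.+1 - s)%:R * gbin x (n.+1 - s) * gbin y s +
   \sum_(s < n.+2) gbin x (n.+1 - s) * (s%:R * gbin y s)).
  rewrite -big_split /=; apply: eq_bigr => s _.
  by rewrite natrB ?(ltn_ord s) -1?ltnS ?ltn_ord //; ring.
rewrite [X in X + _]big_ord_recr [X in _ + X]big_ord_recl /= subnn !mul0r mulr0.
rewrite addr0 add0r.
rewrite -big_split /=; apply: eq_bigr => s _.
have sn : (s <= n)%N by rewrite -ltnS.
rewrite /bump /= add1n subSS gbinS subSn // gbinS natrB //.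
by ring.
Qed.

Lemma horner_jacobi1 (R : realType) (a b : R) (n : nat) :
  (jacobi a b n).[1] = gbin (n%:R + a) n.
Proof.
rewrite /jacobi horner_sum big_ord_recl /= big1 => [|s _].
  rewrite addr0 subn0 gbin0 expr0 !hornerE.
  by rewrite /= mulVf ?pnatr_eq0 // expr1n !mulr1.
rewrite /bump /= add1n !hornerE subrr.
by rewrite /= mulr0 expr0n /= ?(mul0r, mulr0).
Qed.

Lemma size_jacobi (R : realType) (a b : R) (n : nat) :
  -1 < a -> -1 < b -> size (jacobi a b n) = n.+1.
Proof.
move=> a1 b1.
pose p s : {poly R} := ('X - 1) ^+ s * ('X + 1) ^+ (n - s).
have pE s : (s <= n)%N -> p s \is monic /\ size (p s) = n.+1.
  move=> sn; have m1 : ('X - 1 : {poly R}) \is monic by exact: monicXsubC.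
  have m2 : ('X + 1 : {poly R}) \is monic by exact: monicXaddC.
  have ms : ('X - 1 : {poly R}) ^+ s \is monic by exact: monic_exp.
  have mt : ('X + 1 : {poly R}) ^+ (n - s) \is monic by exact: monic_exp.
  split; first by rewrite /p monicMl.
  rewrite /p size_proper_mul; last first.
    by rewrite (monicP ms) (monicP mt) mul1r oner_neq0.
  have -> : ('X + 1 : {poly R}) = 'X - (- 1)%:P by rewrite polyCN opprK.
  by rewrite !size_exp_XsubC addnS /= addSn subnKC.
have jE : jacobi a b n = \sum_(s < n.+1)
    (gbin (n%:R + a) (n - s) * gbin (n%:R + b) s * 2^-1 ^+ n) *: p s.
  apply: eq_bigr => s _; move: (_ * gbin _ _) => c.
  rewrite !exprZn -(scalerAl (2^-1 ^+ s)) -scalerAr !scalerA -mulrA.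
  by rewrite -exprD subnKC // -ltnS.
have szle : (size (jacobi a b n) <= n.+1)%N.
  rewrite jE (leq_trans (size_sum _ _ _)) //; apply/bigmax_leqP => s _.
  rewrite (leq_trans (size_scale_leq _ _)) //.
  by have [|_ ->] := pE s; rewrite // -ltnS.
apply/eqP; rewrite eqn_leq szle /=; rewrite ltnNge; apply/negP => sz.
have : (jacobi a b n)`_n = 0 by exact: nth_default.
rewrite jE coef_sum.
under eq_bigr => s _.
  rewrite coefZ; have [|/monicP ms szs] := pE s; first by rewrite -ltnS.
  move: ms; rewrite /lead_coef szs /= => ->; rewrite mulr1; over.
rewrite -mulr_suml gbin_Vandermonde; apply/eqP; rewrite mulf_neq0 //.
  rewrite /gbin mulf_neq0 ?invr_eq0 ?pnatr_eq0 -?lt0n ?fact_gt0 //.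
  apply/prodf_neq0 => i _; rewrite gt_eqF //.
  have : (i.+1%:R <= n%:R :> R) by rewrite ler_nat ltn_ord.
  have : (1 <= n%:R :> R) by rewrite ler1n (leq_trans _ (ltn_ord i)).
  by rewrite -natr1; lra.
Qed.

(* Main.v *)
(* Differentiating the Leibniz expansion of P_n^(a,b) term by term gives
   d/dx P_n^(a,b) = (n + a + b + 1)/2 P_(n-1)^(a+1,b+1), while
   w_(a+1,b) + w_(a,b+1) = ((1 - x) + (1 + x)) w_(a,b) = 2 w_(a,b).  The
   integrands thus agree pointwise, and linearity of the integral applies because
   polynomial multiples of a Jacobi weight are integrable: the weight is dominated
   by a multiple of (1 - x)^a + (1 + x)^b, whose primitive on (-1, 1) is bounded. *)
Require Import Defs.
From HB Require Import structures.
From mathcomp Require Import all_boot all_order all_algebra.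
From mathcomp Require Import all_classical all_reals all_analysis.
From mathcomp Require Import measurable_realfun ring lra.

Import Order.TTheory GRing.Theory Num.Theory.
Import numFieldNormedType.Exports.

Local Open Scope ring_scope.

(** * Differentiation of Jacobi polynomials *)

Lemma deriv_jacobi (R : realType) (a b : R) (n : nat) :
  (jacobi a b n.+1)^`() =
  ((n.+1%:R + a + b + 1) / 2) *: jacobi (a + 1) (b + 1) n.
Proof.
pose u : {poly R} := 2^-1 *: ('X - 1); pose v : {poly R} := 2^-1 *: ('X + 1).
pose c s := gbin (n.+1%:R + a) (n.+1 - s) * gbin (n.+1%:R + b) s.
pose d s := gbin (n.+1%:R + a) (n - s) * gbin (n.+1%:R + b) s.
have du : u^`() = (2^-1)%:P.
  by rewrite /u derivZ derivB derivX derivC subr0 -mul_polyC mulr1.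
have dv : v^`() = (2^-1)%:P.
  by rewrite /v derivZ derivD derivX derivC addr0 -mul_polyC mulr1.
(* By [gbinS] the two products are (n + 1 + b - s) [d s] and (1 + a + s) [d s], and s cancels in the
   sum of the factors. *)
have cE s : (s <= n)%N ->
    s.+1%:R * c s.+1 + (n.+1 - s)%:R * c s = (n.+1%:R + a + b + 1) * d s.
  move=> sn; rewrite /c /d subSS (subSn sn) [s.+1%:R * _]mulrCA gbinS.
  rewrite [_.+1%:R * _]mulrA gbinS natrB // -!natr1.
  ring.
(* Lowering the degree while raising both parameters keeps the upper entries of the binomials: n +
   (a + 1) = (n + 1) + a. *)
have jE : jacobi (a + 1) (b + 1) n = \sum_(s < n.+1) d s *: (u ^+ s * v ^+ (n - s)).
  rewrite /jacobi (_ : n%:R + (a + 1) = n.+1%:R + a); last by rewrite -natr1; ring.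
  by rewrite (_ : n%:R + (b + 1) = n.+1%:R + b) //; rewrite -natr1; ring.
rewrite jE /jacobi -/u -/v raddf_sum /=.
transitivity (2^-1 *: (
    \sum_(s < n.+2) (s%:R * c s) *: (u ^+ s.-1 * v ^+ (n.+1 - s)) +
    \sum_(s < n.+2) ((n.+1 - s)%:R * c s) *: (u ^+ s * v ^+ (n.+1 - s).-1))).
  rewrite -big_split scaler_sumr; apply: eq_bigr => s _ /=.
  rewrite derivZ derivM !deriv_exp du dv -/(c s); move: (c s) => e.
  rewrite -[_ * _ *+ s]scaler_nat -[_ * _ *+ (n.+1 - s)]scaler_nat !mul_polyC.
  rewrite -!scalerAl -!scalerAr !scalerDr !scalerA.
  by congr (_ *: _ + _ *: _); ring.
(* The terms dropped, s = 0 and s = n + 1, are those where [.-1] truncates; their coefficients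
   vanish. Shifting the first sum by one aligns the monomials u^s v^(n-s). *)
rewrite big_ord_recl [X in _ + X]big_ord_recr /= subnn !mul0r !scale0r add0r addr0.
rewrite -big_split scaler_sumr scaler_sumr; apply: eq_bigr => s _ /=.
have sn : (s <= n)%N by rewrite -ltnS.
rewrite /bump /= add1n subSS (subSn sn) /= -scalerDl !scalerA; congr (_ *: _).
by rewrite mulrAC -cE // (subSn sn); ring.
Qed.

(** * Integrability of polynomials against Jacobi weights *)

(** Since f may blow up at the endpoints, the fundamental theorem of calculus is applied on closed
    intervals [E n] increasing to the open one; it bounds each integral uniformly, and monotone
    convergence passes to the limit. *)
Lemma integrable_bounded_primitive (R : realType) (f F : R -> R) (a b M : R) :
  {in `]a, b[, forall x, 0 <= f x} ->
  {in `]a, b[, continuous f} ->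
  {in `]a, b[, forall x : R, is_derive x (1 : R) F (f x)} ->
  {in `]a, b[, forall x, `|F x| <= M} ->
  (@lebesgue_measure R).-integrable `]a, b[%classic (EFin \o f).
Proof.
move=> f0 cf dF FM.
pose E (n : nat) : set R := `[a + n.+1%:R^-1, b - n.+1%:R^-1]%classic.
have sE n : (E n `<=` `]a, b[)%classic.
  have n0 : 0 < n.+1%:R^-1 :> R by rewrite invr_gt0.
  move=> x; rewrite /E /= !in_itv /=; move: n0; set e := _^-1.
  by move=> ? /andP[? ?]; apply/andP; split; lra.
have UE : (\bigcup_n E n = `]a, b[)%classic.
  apply/seteqP; split => [x [n _ /sE] //|x]; rewrite /= in_itv /= => /andP[ax xb].
  have [k hk] := ltr_add_invr ax.
  have [m hm] := ltr_add_invr xb.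
  have inv_le i j : (i <= j)%N -> j.+1%:R^-1 <= i.+1%:R^-1 :> R.
    by move=> ij; rewrite lef_pV2 ?posrE // ler_nat.
  exists (maxn k m) => //; rewrite /E /= in_itv /= lerBrDr.
  rewrite (le_trans _ (ltW hk)) ?(le_trans _ (ltW hm)) // lerD2l inv_le //.
    exact: leq_maxr.
  exact: leq_maxl.
have ndE : nondecreasing_seq E.
  move=> m n mn; apply/subsetPset => x; rewrite /E /= !in_itv /=.
  have : n.+1%:R^-1 <= m.+1%:R^-1 :> R by rewrite lef_pV2 ?posrE // ler_nat ltnS.
  set e := n.+1%:R^-1; set e' := m.+1%:R^-1.
  by move=> ? /andP[? ?]; apply/andP; split; lra.
have mf : measurable_fun `]a, b[%classic f.
  apply: open_continuous_measurable_fun; first exact: interval_open.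
  by move=> x; rewrite inE => /cf.
have mEf : measurable_fun `]a, b[%classic (EFin \o f) by exact/measurable_EFinP.
apply/integrableP; split => //.
under eq_integral => x.
  rewrite inE => /f0 fx; rewrite /= ger0_norm //; over.
have dF' : {in `]a, b[, forall x : R, derivable F x 1}.
  by move=> x /dF dFx; exact: ex_derive.
have cF : {in `]a, b[, continuous F}.
  by move=> x /dF' dFx; apply: differentiable_continuous; exact/derivable1_diffP.
(* The absolute value keeps the bound nonnegative when the interval is empty and M may be
   negative. *)
apply: (@le_lt_trans _ _ (2 * `|M|)%:E); last exact: ltry.
have cvgE : (\int[lebesgue_measure]_(x in E n) (EFin \o f) x @[n --> \oo] -->
    \int[lebesgue_measure]_(x in \bigcup_n E n) (EFin \o f) x)%E%classic.
  apply: ge0_nondecreasing_set_cvg_integral => // [n|n|n x /sE /f0 //].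
    exact: measurable_itv.
  exact: measurable_funS (sE n) mEf.
rewrite -UE; apply: (cvge_to_le cvgE).
near=> n; have := sE n; rewrite /E; set c := a + _; set d := b - _ => scd.
have [cd|dc] := ltP c d; last first.
  have [<-|ndc] := eqVneq c d; first by rewrite set_itv1 integral_set1 lee_fin mulr_ge0.
  rewrite set_itv_ge ?integral_set0 ?lee_fin ?mulr_ge0 //.
  by rewrite bnd_simp -ltNge lt_neqAle eq_sym ndc.
have cE : c \in `]a, b[ by apply: scd; rewrite /= in_itv /= lexx ltW.
have dE : d \in `]a, b[ by apply: scd; rewrite /= in_itv /= lexx ltW.
rewrite (@continuous_FTC2 _ f F) //.
- rewrite -EFinB lee_fin (le_trans (ler_norm _)) // (le_trans (ler_normB _ _)) //.
  by have := FM c cE; have := FM d dE; have := ler_norm M; lra.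
- by apply: continuous_in_subspaceT => x; rewrite inE => /scd /cf.
- split.
  + by move=> x xcd; apply/dF'/scd; apply: subset_itv_oo_cc.
  + by apply: cvg_at_right_filter; exact: cF.
  + by apply: cvg_at_left_filter; exact: cF.
- move=> x xcd; rewrite derive1E; apply: derive_val; apply/dF/scd.
  exact: subset_itv_oo_cc.
Unshelve. all: by end_near. Qed.

Lemma is_derive_powR_onem (R : realType) (c x : R) : x < 1 ->
  is_derive x (1 : R) (fun y : R => (1 - y) `^ c) (- (c * (1 - x) `^ (c - 1))).
Proof.
move=> x1; have x0 : 0 < 1 - x by lra.
have dg : is_derive x (1 : R) (fun y : R => 1 - y) (- 1).
  by apply: is_derive_eq; ring.
apply: is_derive_eq; first exact: (is_derive1_comp (g := fun y : R => 1 - y)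
  (is_derive1_powR c x0) dg).
by rewrite mulrN1.
Qed.

Lemma is_derive_powR_1D (R : realType) (c x : R) : -1 < x ->
  is_derive x (1 : R) (fun y : R => (1 + y) `^ c) (c * (1 + x) `^ (c - 1)).
Proof.
move=> x1; have x0 : 0 < 1 + x by lra.
have dg : is_derive x (1 : R) (fun y : R => 1 + y) 1.
  by apply: is_derive_eq; ring.
apply: is_derive_eq; first exact: (is_derive1_comp (g := fun y : R => 1 + y)
  (is_derive1_powR c x0) dg).
by rewrite mulr1.
Qed.

(** Unlike the product of the two powers, their sum has an elementary primitive; it is bounded
    because a + 1 and b + 1 are positive and both bases lie in [0, 2]. *)
Lemma integrable_powR_endpoints (R : realType) (a b : R) :
  -1 < a -> -1 < b ->
  (@lebesgue_measure R).-integrable `]-1, 1[%classic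
    (EFin \o (fun x : R => (1 - x) `^ a + (1 + x) `^ b)).
Proof.
move=> a1 b1; have a0 : 0 < a + 1 by lra.
have b0 : 0 < b + 1 by lra.
pose F (x : R) := (b + 1)^-1 * (1 + x) `^ (b + 1) - (a + 1)^-1 * (1 - x) `^ (a + 1).
pose M : R := (b + 1)^-1 * 2 `^ (b + 1) + (a + 1)^-1 * 2 `^ (a + 1).
have dF : {in `]-1, 1[, forall x : R,
    is_derive x (1 : R) F ((1 - x) `^ a + (1 + x) `^ b)}.
  move=> x; rewrite in_itv /= => /andP[x1 x2].
  have d1 := is_derive_powR_onem _ (a + 1) _ x2.
  have d2 := is_derive_powR_1D _ (b + 1) _ x1.
  have dZ := is_deriveB (is_deriveZ (b + 1)^-1 d2) (is_deriveZ (a + 1)^-1 d1).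
  apply: (is_derive_eq dZ).
  rewrite !addrK /GRing.scale /= mulrN opprK.
  by rewrite !mulKf ?gt_eqF // addrC.
apply: (@integrable_bounded_primitive _ _ F _ _ M) => // x.
- by rewrite addr_ge0 ?powR_ge0.
- rewrite in_itv /= => /andP[x1 x2].
  have d1 := is_derive_powR_onem _ a _ x2.
  have d2 := is_derive_powR_1D _ b _ x1.
  apply: differentiable_continuous; apply/derivable1_diffP.
  by apply: derivableD; exact: ex_derive.
- rewrite in_itv /= => /andP[x1 x2].
  have norm_le (c y : R) : 0 < c + 1 -> 0 <= y <= 2 ->
      `|(c + 1)^-1 * y `^ (c + 1)| <= (c + 1)^-1 * 2 `^ (c + 1).
    move=> c0 /andP[y0 y2].
    rewrite ger0_norm ?mulr_ge0 ?invr_ge0 ?powR_ge0 ?(ltW c0) //.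
    by rewrite ler_pM2l ?invr_gt0 // ge0_ler_powR ?nnegrE ?(ltW c0).
  by rewrite (le_trans (ler_normB _ _)) // lerD // norm_le //; lra.
Qed.

(** On each half of [-1, 1] one base lies in [1, 2], so its power is at most 2 to the absolute value
    of the exponent, whatever its sign; the other power is a summand on the right. *)
Lemma jweight_le (R : realType) (a b x : R) : -1 <= x <= 1 ->
  jweight a b x <= (2 `^ `|a| + 2 `^ `|b|) * ((1 - x) `^ a + (1 + x) `^ b).
Proof.
have powR_le (y c : R) : 1 <= y <= 2 -> y `^ c <= 2 `^ `|c|.
  move=> /andP[y1 y2]; rewrite (le_trans (ler_powR y1 (ler_norm c))) //.
  by rewrite ge0_ler_powR // ?nnegrE; lra.
move=> /andP[x1 x2]; rewrite /jweight.
have pa := powR_ge0 (1 - x) a; have pb := powR_ge0 (1 + x) b.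
have qa := powR_ge0 2 `|a|; have qb := powR_ge0 2 `|b|.
have [x0|x0] := leP 0 x.
  have h : (1 + x) `^ b <= 2 `^ `|b| by apply: powR_le; lra.
  nra.
have h : (1 - x) `^ a <= 2 `^ `|a| by apply: powR_le; lra.
nra.
Qed.

Lemma integrable_poly_jweight (R : realType) (p : {poly R}) (a b l r : R) :
  -1 < a -> -1 < b -> -1 <= l -> r <= 1 ->
  (@lebesgue_measure R).-integrable `[l, r]%classic
    (EFin \o (fun x => p.[x] * jweight a b x)).
Proof.
move=> a1 b1 l1 r1.
have mw : measurable_fun setT (jweight a b).
  apply: measurable_funM; apply: (measurableT_comp (f := @powR R ^~ _)) => //.
    exact: measurable_funB.
  exact: measurable_funD.
apply: (@integrableS _ _ _ lebesgue_measure `[-1, 1]%classic) => //.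
  by move=> x; rewrite /= !in_itv /= => /andP[? ?]; apply/andP; split; lra.
apply: (@integrableMr _ _ _ lebesgue_measure `[-1, 1]%classic _ (horner p)
  (EFin \o jweight a b)) => //.
- apply: measurable_funTS; apply: continuous_measurable_fun.
  exact: continuous_horner.
(* A polynomial is bounded on a compact interval, so only the weight itself has to be integrable. *)
- have : bounded_set (horner p @` `[-1, 1])%classic.
    apply: compact_bounded; apply: continuous_compact; last exact: segment_compact.
    by apply: continuous_subspaceT; exact: continuous_horner.
  case=> M [Mr MP]; exists M; split=> // y My x x11.
  by apply: (MP y My); exists x.
have mEw (A : set R) : measurable_fun A (EFin \o jweight a b).
  by apply/measurable_EFinP; exact: measurable_funTS.
have : (@lebesgue_measure R).-integrable `]-1, 1[%classic (EFin \o jweight a b).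
  apply: (@le_integrable _ _ _ lebesgue_measure _ _ _
    (fun x => (2 `^ `|a| + 2 `^ `|b|)%:E * ((1 - x) `^ a + (1 + x) `^ b)%:E)%E) => //.
  - exact: mEw.
  - move=> x; rewrite /= in_itv /= => /andP[x1 x2].
    have g0 y : 0 <= (2 `^ `|a| + 2 `^ `|b|) * ((1 - y) `^ a + (1 + y) `^ b) :> R.
      by rewrite mulr_ge0 ?addr_ge0 ?powR_ge0.
    rewrite (ger0_norm (g0 x)) lee_fin ger0_norm ?mulr_ge0 ?powR_ge0 //.
    by rewrite jweight_le // !ltW.
  - by apply: integrableZl => //; exact: integrable_powR_endpoints.
move=> /integrableP[_ fin]; apply/integrableP; split; first exact: mEw.
(* The two endpoints form a null set, so the open interval suffices. *)
by rewrite integral_itv_bndoo //; exact: measurableT_comp.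
Qed.

(** * The matrix identity *)

(** Splitting off one factor 1 - x or 1 + x is valid even where it vanishes: the raised exponent is
    positive, so both sides are 0 there. *)
Lemma jweightD1 (R : realType) (a b x : R) :
  -1 < a -> -1 < b -> -1 <= x <= 1 ->
  jweight (a + 1) b x + jweight a (b + 1) x = 2 * jweight a b x.
Proof.
move=> a1 b1 /andP[x1 x2]; rewrite /jweight.
rewrite -[(1 - x) `^ (a + 1)]mulr_powRB1; [|lra|lra].
rewrite -[(1 + x) `^ (b + 1)]mulr_powRB1; [|lra|lra].
by rewrite !addrK; ring.
Qed.

Theorem theorem3 (R : realType) (alpha beta : R) (N : nat)
    (l r : 'I_N -> R)
    (halpha : -1 < alpha) (hbeta : -1 < beta) (hN : (1 <= N)%N)
    (hl : forall i, -1 <= l i) (hlr : forall i, l i < r i)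
    (hr : forall i, r i <= 1)
    (hadm : admissible (jweight alpha beta) l r) :
  jacobiD alpha beta l r =
    (2^-1 *: (jacobiA alpha beta l r + jacobiB alpha beta l r))
      *m jacobiC alpha beta N.
Proof.
(* The diagonal factor scales column [k]. Columns count from 0, so the degrees are [k.+1] on the
   left and [k] on the right, as in [deriv_jacobi]. *)
apply/matrixP => i k; rewrite mul_mx_diag !mxE.
have int a b : -1 < a -> -1 < b -> (@lebesgue_measure R).-integrable
    `[l i, r i]%classic (EFin \o (fun x =>
      (jacobi (alpha + 1) (beta + 1) k).[x] * jweight a b x)).
  by move=> a1 b1; exact: integrable_poly_jweight.
have intA : -1 < alpha + 1 by lra.
have intB : -1 < beta + 1 by lra.
have {}intA := int _ _ intA hbeta; have {}intB := int _ _ halpha intB.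
rewrite -RintegralD // mulrAC -RintegralZl //; last exact: (integrableD _ intA intB).
apply: eq_Rintegral => x; rewrite inE /= in_itv /= => /andP[lx xr].
rewrite -derivE deriv_jacobi hornerZ.
rewrite -mulrDr jweightD1 ?(le_trans (hl i) lx) ?(le_trans xr (hr i)) //.
by field.
Qed.
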